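(* Let $G$ and $H$ be two simple undirected graphs with $n$ vertices each. Then $G\cong H$ (graph isomorphism) if and only if $M[\beta(G,n)]\cong_s M[\beta(H,n)]$ for any coding sequences $\beta(G,n)$ and $\beta(H,n)$ of $G$ and $H$ respectively.
   Context: Coding sequences: for a simple graph $G=(V,E)$ with $n$ vertices, choose a labeling $V=\{v_0,\ldots,v_{n-1}\}$ (vertex $v_i$ is also called $10^i$). For an edge $e=v_iv_j$ with $i>j$ let $f^\#(e)=(x_1,\ldots,x_{n-1})\in\mathbb{Z}_2^{n-1}$ with $x_k=1$ iff $n-i\le k\le n-j-1$ and $x_k=0$ otherwise. The coding sequence $\beta(G,n)$ (for that labeling) is $\{f^\#(e):e\in E\}$. $C(n-1)$ denotes the set of non-zero vectors of $\mathbb{Z}_2^{n-1}$ whose $1$'s occupy consecutive coordinates (consecutive $1$'s property). For a non-empty $S\subseteq\mathbb{Z}_2^{n-1}$, $M[S]$ is the binary column matroid of the $\mathbb{Z}_2$-matrix whose columns are exactly the elements of $S$ (independent sets are the linearly independent subsets of $S$); a binary matroid $M[A]$ is identified with the set of columns of $A$. A binary matroid $M[A]$ is a simple segment binary matroid if the columns of $A$ are non-zero, pairwise distinct, and each column has the consecutive $1$'s property. Strong isomorphism: two simple segment binary matroids $M[A_1]$, $M[A_2]$ are strongly isomorphic, written $M[A_1]\cong_s M[A_2]$, if (1) $A_1,A_2$ are $(n-1)\times m$ matrices over $\mathbb{Z}_2$ for some $m,n\in\mathbb{N}$, $n\ge 2$, and (2) there exists a bijective linear operator $T$ on $\mathbb{Z}_2^{n-1}$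 such that (i) $T$ restricted to $C(n-1)$ is a bijection of $C(n-1)$ onto itself, and (ii) $T$ restricted to the set of columns of $A_1$ is a bijection onto the set of columns of $A_2$. *)

(* Defs.v *)
(* Mathematical Components *)
From mathcomp Require Import all_boot all_order all_algebra.

Set Implicit Arguments.
Unset Strict Implicit.
Unset Printing Implicit Defensive.

Import GRing.Theory.
Local Open Scope ring_scope.

Record sgraph := SGraph {
  vertex : finType;
  adj : rel vertex;
  adj_sym : symmetric adj;
  adj_irr : irreflexive adj }.

Definition graph_iso (G H : sgraph) : Prop :=
  exists2 f : vertex G -> vertex H,
    bijective f & forall x y, adj (f x) (f y) = adj x y.

Record matroid (T : finType) := Matroid {
  ground : {set T};
  indep : {set {set T}};
  indep_ground : forall I, I \in indep -> I \subset ground;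
  indep0 : set0 \in indep;
  indepS : forall I J : {set T}, J \subset I -> I \in indep -> J \in indep;
  indep_aug : forall I J : {set T}, I \in indep -> J \in indep ->
    (#|I| < #|J|)%N -> exists2 x, x \in J :\: I & x |: I \in indep }.

Section ColumnMatroid.
Variable d : nat.
Local Notation vec := 'cV['F_2]_d.
Implicit Types (S I J : {set vec}).

Definition lin_indep S : {set {set vec}} :=
  [set I : {set vec} | (I \subset S) && free (enum I)].

Lemma lin_indep_ground S I : I \in lin_indep S -> I \subset S.
Proof. by rewrite inE => /andP[]. Qed.

Lemma lin_indep0 S : set0 \in lin_indep S.
Proof. by rewrite inE sub0set enum_set0 nil_free. Qed.

Lemma lin_indepS S I J :
  J \subset I -> I \in lin_indep S -> J \in lin_indep S.
Proof.
move=> JI; rewrite !inE => /andP[IS fI]; rewrite (subset_trans JI IS) /=.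
have /perm_free -> : perm_eq (enum J) [seq x <- enum I | x \in J].
  apply: uniq_perm => [||x]; [exact: enum_uniq | by rewrite filter_uniq ?enum_uniq |].
  rewrite mem_enum mem_filter mem_enum.
  by case xJ: (x \in J) => //; rewrite (subsetP JI).
exact: filter_free.
Qed.

Lemma lin_indep_aug S I J : I \in lin_indep S -> J \in lin_indep S ->
  (#|I| < #|J|)%N -> exists2 x, x \in J :\: I & x |: I \in lin_indep S.
Proof.
rewrite !inE => /andP[IS fI] /andP[JS fJ] ltIJ.
have /subsetPn[x xJ xI] : ~~ (J \subset <<enum I>>%VS).
  apply/negP => /subsetP JI; move: ltIJ; rewrite ltnNge => /negP; apply.
  have := dimvS (_ : (<<enum J>> <= <<enum I>>)%VS).
  rewrite (eqP fJ) (eqP fI) -!cardE; apply.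
  by apply/span_subvP => y; rewrite mem_enum => /JI.
have xNI : x \notin I.
  by apply: contra xI => xI; rewrite memv_span ?mem_enum.
exists x; first by rewrite inE xNI.
rewrite inE subUset sub1set (subsetP JS) // IS /=.
have /perm_free -> : perm_eq (enum (x |: I)) (x :: enum I).
  apply: uniq_perm; rewrite /= ?enum_uniq ?mem_enum ?xNI //.
  by move=> y; rewrite !(mem_enum, inE).
by rewrite free_cons xI.
Qed.

(* M[A] depends on A only through its set S of columns; S may be empty
   (matrix with no columns, as for an edgeless graph). *)
Definition column_matroid S : matroid vec :=
  Matroid (@lin_indep_ground S) (lin_indep0 S) (@lin_indepS S)
          (@lin_indep_aug S).

Definition columns m (A : 'M['F_2]_(d, m)) : {set vec} :=
  [set col j A | j : 'I_m].

(* The set C(d): a vector has consecutive 1's iff every coordinate lying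
   between two 1's is itself a 1. *)
Definition segments : {set vec} :=
  [set x : vec | (x != 0) &&
    [forall a : 'I_d, forall b : 'I_d, forall c : 'I_d,
      [&& (a <= b <= c)%N, x a 0 == 1 & x c 0 == 1] ==> (x b 0 == 1)]].

Definition simple_segment m (A : 'M['F_2]_(d, m)) : Prop :=
  injective (fun j => col j A) /\ columns A \subset segments.

Definition bij_onto (f : vec -> vec) S S' : Prop :=
  {in S &, injective f} /\ f @: S = S'.

(* Vectors live in dimension d = n - 1, so n >= 2 reads 0 < d. *)
Definition strongly_iso (M1 M2 : matroid vec) : Prop :=
  (0 < d)%N /\
  exists m (A1 A2 : 'M['F_2]_(d, m)),
    [/\ simple_segment A1 /\ M1 = column_matroid (columns A1),
        simple_segment A2 /\ M2 = column_matroid (columns A2)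
      & exists T : {linear vec -> vec},
          [/\ bijective T,
              bij_onto T segments segments
            & bij_onto T (columns A1) (columns A2)]].

End ColumnMatroid.

(* Coordinates are counted from 0 here: k : 'I_n.-1 is the coordinate x_(k+1). *)
Definition edge_code n (i j : 'I_n) : 'cV['F_2]_n.-1 :=
  \col_k (if (n - i <= k.+1 <= n - j - 1)%N then 1 else 0).

Definition coding_seq n (G : sgraph) (v : 'I_n -> vertex G) :
    {set 'cV['F_2]_n.-1} :=
  [set edge_code p.1 p.2 | p : 'I_n * 'I_n & (p.2 < p.1)%N &&
                                           adj (v p.1) (v p.2)].

(* Main.v *)
Require Import Defs.
From mathcomp Require Import all_boot all_order all_algebra.
From mathcomp Require Import all_fingroup zify.

(** Let u_i be the indicator of the first n-1-i coordinates.  The code of the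
edge v_i v_j is u_i + u_j, and the segments are exactly the vectors u_i + u_j
with i <> j: they form the cycle matroid of the complete graph.  Since
(u_i + u_j) + (u_i + u_k) = u_j + u_k, a vertex permutation acts linearly and
preserves segments.  Conversely, let T be linear, injective and preserve
segments, and fix a vertex o.  The edges T(oj) pairwise share a vertex because
T(oj) + T(ok) = T(jk) is again an edge, and they cannot close up into a triangle
because T(jk) is not of the form T(ol).  So they all pass through one vertex,
T(oj) = a b_j, and j |-> b_j is a permutation inducing T. *)

Set Implicit Arguments.
Unset Strict Implicit.
Unset Printing Implicit Defensive.

Import GRing.Theory.
Local Open Scope ring_scope.

(** * Booleans as scalars of the two-element field *)

Lemma natr_addb (a b : bool) : a%:R + b%:R = (a (+) b)%:R :> 'F_2.
Proof. by case: a; case: b; apply/val_inj. Qed.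

Lemma natr_bool_eq1 (b : bool) : (b%:R == 1 :> 'F_2) = b.
Proof. by case: b. Qed.

Lemma F2_bool (x : 'F_2) : x = (x == 1)%:R.
Proof. by case: x => -[|[|?]] // ?; apply/val_inj. Qed.

Lemma addrr_F2 d (x : 'cV['F_2]_d) : x + x = 0.
Proof.
by apply/matrixP => i j; rewrite !mxE [x i j]F2_bool natr_addb addbb.
Qed.

Lemma sum_at (m t : nat) (p : pred nat) :
  \sum_(k < m) (p k && (k == t :> nat))%:R = (p t && (t < m)%N)%:R :> 'F_2.
Proof.
have [tm|mt] := ltnP t m.
  rewrite (bigD1 (Ordinal tm)) //= eqxx big1 ?addr0 // => k /negPf.
  by rewrite -val_eqE /= => ->; rewrite andbF.
by rewrite andbF big1 // => k _; case: eqP (ltn_ord k) => [-> | _ _]; [lia | rewrite andbF].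
Qed.

(** * Edges of the complete graph as vectors, and their end vertices *)

Section Chords.
Variable n : nat.
Implicit Types (i j a b c : 'I_n) (x y : 'cV['F_2]_n.-1) (r : rel 'I_n).

(* Column i is the vector u_i of the header. *)
Definition prefix_mx : 'M['F_2]_(n.-1, n) :=
  \matrix_(k, i) (k.+1 + i < n)%N%:R.

(* Sends u_i + u_j to the indicator of {i, j}, whence u_i + u_j determines {i, j}. *)
Definition boundary_mx : 'M['F_2]_(n, n.-1) :=
  \matrix_(i, k) ((k.+1 + i == n) (+) (k.+1 + i.+1 == n))%N%:R.

Definition chord i j : 'cV['F_2]_n.-1 :=
  prefix_mx *m (delta_mx i 0 + delta_mx j 0).

(** Row j compares neighbouring coordinates, and u_i jumps only at j = i. The extra term in the last
    row is the same for all i, so it cancels in a chord. *)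
Lemma boundary_prefix j i :
  (boundary_mx *m prefix_mx) j i = ((j == i) (+) (j.+1 == n))%:R.
Proof.
rewrite !mxE.
(* The guard [j.+1 < n] excludes the last row, where [n - j.+2] truncates to 0. *)
transitivity (
  \sum_(k < n.-1) (((k.+1 + i < n) && (j < n))%N && (k == n - j.+1 :> nat)%N)%:R +
  \sum_(k < n.-1) (((k.+1 + i < n) && (j.+1 < n))%N && (k == n - j.+2 :> nat)%N)%:R
  : 'F_2).
  rewrite -big_split; apply: eq_bigr => k _ /=; rewrite !mxE natr_addb -natrM mulnb.
  by congr (nat_of_bool _)%:R; have := ltn_ord k; have := ltn_ord j; lia.
rewrite (sum_at _ (n - j.+1) (fun k => (k.+1 + i < n) && (j < n))%N).
rewrite (sum_at _ (n - j.+2) (fun k => (k.+1 + i < n) && (j.+1 < n))%N).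
rewrite natr_addb -val_eqE /=.
by congr (nat_of_bool _)%:R; have := ltn_ord i; have := ltn_ord j; lia.
Qed.

Lemma boundary_chord a b :
  boundary_mx *m chord a b = delta_mx a 0 + delta_mx b 0.
Proof.
rewrite /chord mulmxA mulmxDr -!colE; apply/matrixP => j o.
rewrite ord1 [LHS]mxE [X in X + _]mxE [X in _ + X]mxE !boundary_prefix !mxE.
by rewrite !andbT !natr_addb addbACA addbb addbF.
Qed.

Lemma chord_entry a b k :
  chord a b k 0 = ((k.+1 + a < n) (+) (k.+1 + b < n))%N%:R.
Proof. by rewrite /chord mulmxDr -!colE !mxE natr_addb. Qed.

Lemma chordC a b : chord a b = chord b a.
Proof. by rewrite /chord addrC. Qed.

Lemma chordD a b c : chord a b + chord a c = chord b c.
Proof. by rewrite /chord -mulmxDr addrACA addrr_F2 add0r. Qed.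

Lemma chordxx a : chord a a = 0.
Proof. by rewrite /chord addrr_F2 mulmx0. Qed.

(** Incidence of vertex j with an edge vector, extended additively to all vectors. *)
Definition on_chord x j := (boundary_mx *m x) j 0 == 1.

Lemma on_chordE a b j : on_chord (chord a b) j = (j == a) (+) (j == b).
Proof.
by rewrite /on_chord boundary_chord !mxE eqxx !andbT natr_addb natr_bool_eq1.
Qed.

Lemma on_chordD x y j : on_chord (x + y) j = on_chord x j (+) on_chord y j.
Proof.
rewrite /on_chord mulmxDr mxE.
by rewrite [X in X + _]F2_bool [X in _ + X]F2_bool natr_addb natr_bool_eq1.
Qed.

Lemma chord_inj a b c d : chord a b = chord c d -> c != d ->
  (a = c /\ b = d) \/ (a = d /\ b = c).
Proof.
move=> E cd.
have P j : (j == a) (+) (j == b) = (j == c) (+) (j == d).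
  by rewrite -!on_chordE E.
move: (P c) (P d) (P a); rewrite !eqxx (negPf cd) [d == c]eq_sym (negPf cd) /=.
by do !case: eqP => //=; move=> *; subst; rewrite ?eqxx in cd *; auto.
Qed.

Lemma chord_eq0 a b : (chord a b == 0) = (a == b).
Proof.
apply/eqP/eqP => [E | ->]; last exact: chordxx.
apply/eqP/negPn/negP => ab.
by have := @chord_inj a a a b; rewrite chordxx E => /(_ erefl ab) [] [] *; subst;
   rewrite eqxx in ab.
Qed.

(** Disjoint edges would sum to a vector incident with four vertices, while [chord e f] is incident
    with at most two. *)
Lemma chord_adj a b c d e f : chord a b + chord c d = chord e f ->
  a != b -> c != d -> [|| a == c, a == d, b == c | b == d].
Proof.
move=> E ab cd; apply/negPn/negP; rewrite !negb_or => /and4P[ac ad bc bd].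
have P j : (j == a) (+) (j == b) (+) ((j == c) (+) (j == d)) =
    (j == e) (+) (j == f).
  by rewrite -!on_chordE -on_chordD E.
move: (P a) (P b) (P c); rewrite !eqxx [c == a]eq_sym [c == b]eq_sym [b == a]eq_sym.
rewrite (negPf ab) (negPf cd) (negPf ac) (negPf ad) (negPf bc) (negPf bd) /=.
by do !case: eqP => //=; move=> *; subst; rewrite eqxx in ab ac bc.
Qed.

(** * Coding sequences and segments as sets of chords *)

Definition chords r : {set 'cV['F_2]_n.-1} :=
  [set chord p.1 p.2 | p : 'I_n * 'I_n & r p.1 p.2].

Lemma mem_chords r i j : symmetric r -> irreflexive r ->
  (chord i j \in chords r) = r i j.
Proof.
move=> rS rI; apply/imsetP/idP => [[[a b]] | rij]; last first.
  by exists (i, j); rewrite ?inE.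
rewrite inE /= => rab /chord_inj[|[-> ->] //|[-> ->]]; last by rewrite rS.
by apply: contraTneq rab => ->; rewrite rI.
Qed.

Lemma edge_codeE i j : (j < i)%N -> edge_code i j = chord i j.
Proof.
move=> ji; apply/matrixP => k o; rewrite ord1 chord_entry mxE.
have -> : (n - i <= k.+1 <= n - j - 1)%N = (k.+1 + i < n)%N (+) (k.+1 + j < n)%N.
  by have := ltn_ord i; have := ltn_ord k; lia.
by case: (_ (+) _).
Qed.

Lemma coding_seqE (G : sgraph) (v : 'I_n -> vertex G) :
  coding_seq v = chords (fun i j => adj (v i) (v j)).
Proof.
apply/setP => x; apply/imsetP/imsetP => -[[i j]]; rewrite inE /=.
  by case/andP=> ji vij ->; exists (i, j); rewrite ?inE //= edge_codeE.
move=> vij ->; have [ij|ji|/val_inj E] := ltngtP i j.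
- by exists (j, i); rewrite ?inE /= ?ij 1?adj_sym //= edge_codeE // chordC.
- by exists (i, j); rewrite ?inE /= ?ji //= edge_codeE.
- by rewrite E adj_irr in vij.
Qed.

Lemma segmentsE : segments n.-1 = chords (fun i j => i != j).
Proof.
apply/setP => x; apply/idP/imsetP.
  rewrite inE => /andP[x0 /forallP xC].
  have [k0 xk0] : exists k, x k 0 == 1.
    apply/existsP; apply: contraR x0 => /existsPn N; apply/eqP/matrixP => k o.
    by rewrite ord1 [LHS]F2_bool (negPf (N k)) mxE.
  have [lo xlo lomin] := @arg_minnP _ k0 (fun k => x k 0 == 1) val xk0.
  have [hi xhi himax] := @arg_maxnP _ k0 (fun k => x k 0 == 1) val xk0.
  have lohi : (lo <= hi)%N by apply: lomin.
  have hin := ltn_ord hi.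
  (* The run from [lo] to [hi] is the sum of the prefixes of lengths [lo] and [hi.+1]; u_i has
     length n-1-i, which gives these two indices. *)
  have lti : (n - lo.+1 < n)%N by lia.
  have ltj : (n - hi.+2 < n)%N by lia.
  exists (Ordinal lti, Ordinal ltj); first by rewrite inE -val_eqE /=; lia.
  apply/matrixP => k o; rewrite ord1 chord_entry [LHS]F2_bool.
  congr (nat_of_bool _)%:R; rewrite /=.
  have -> : ((k.+1 + (n - lo.+1) < n) (+) (k.+1 + (n - hi.+2) < n))%N =
      (lo <= k <= hi)%N by lia.
  apply/idP/idP => [xk|kk]; first by apply/andP; split; [exact: lomin | exact: himax].
  move: (xC lo) => /forallP/(_ k)/forallP/(_ hi)/implyP; apply.
  by rewrite kk xlo xhi.
case=> -[i j]; rewrite inE /= => ij ->; rewrite inE chord_eq0 ij /=.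
apply/forallP => a; apply/forallP => b; apply/forallP => c; apply/implyP.
by rewrite !chord_entry !natr_bool_eq1; lia.
Qed.

(** * Vertex permutations as linear maps *)

Definition vertex_perm_mx (s : 'S_n) : 'M['F_2]_n.-1 :=
  prefix_mx *m perm_mx s^-1 *m boundary_mx.

(** [perm_mx t] moves the unit vector of i to that of t^-1 i, which is why the matrix is built from
    s^-1. *)
Lemma vertex_perm_chord s i j :
  vertex_perm_mx s *m chord i j = chord (s i) (s j).
Proof.
rewrite /vertex_perm_mx -mulmxA boundary_chord -mulmxA mulmxDr -!row_permE.
congr (_ *m (_ + _)); apply/matrixP => k o;
  by rewrite !mxE (canF_eq (permKV s)).
Qed.

(** Chords of consecutive vertices are the unit vectors, so the chords span the space. *)
Lemma chord_ext m (A B : 'M['F_2]_(m, n.-1)) :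
  (forall i j, A *m chord i j = B *m chord i j) -> A = B.
Proof.
move=> E; apply/matrixP => i k; have kn := ltn_ord k.
have lta : (n - k.+1 < n)%N by lia.
have ltb : (n - k.+2 < n)%N by lia.
have D : chord (Ordinal lta) (Ordinal ltb) = delta_mx k 0.
  apply/matrixP => l o; rewrite ord1 chord_entry mxE eqxx andbT -val_eqE /=.
  by congr (nat_of_bool _)%:R; have := ltn_ord l; lia.
by have := E (Ordinal lta) (Ordinal ltb); rewrite D -!colE => /matrixP/(_ i 0);
   rewrite !mxE.
Qed.

Lemma vertex_perm_mxK s : vertex_perm_mx s^-1 *m vertex_perm_mx s = 1%:M.
Proof.
by apply: chord_ext => i j; rewrite -mulmxA !vertex_perm_chord !permK mul1mx.
Qed.

Lemma vertex_perm_chords (s : 'S_n) r r' : (forall i j, r' (s i) (s j) = r i j) ->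
  mulmx (vertex_perm_mx s) @: chords r = chords r'.
Proof.
move=> rr'; apply/setP => x; apply/imsetP/imsetP => [[y /imsetP[[i j]]]|[[i j]]];
  rewrite inE /= => rij ->.
  by move=> ->; exists (s i, s j); rewrite ?inE /= ?rr' // vertex_perm_chord.
exists (chord ((s^-1)%g i) ((s^-1)%g j)); last by rewrite vertex_perm_chord !permKV.
by apply/imsetP; exists ((s^-1)%g i, (s^-1)%g j); rewrite // inE /= -rr' !permKV.
Qed.

(** * From segment-preserving linear maps to vertex permutations *)

Lemma chord_star (hn : (2 <= n)%N) (T : {linear 'cV['F_2]_n.-1 -> 'cV['F_2]_n.-1})
    (o : 'I_n) : injective T ->
    (forall x, x \in segments n.-1 -> T x \in segments n.-1) ->
  exists a, forall j, exists b, T (chord o j) = chord a b.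
Proof.
move=> Tinj Tseg.
have seg i j : i != j -> exists p : 'I_n * 'I_n,
    p.1 != p.2 /\ T (chord i j) = chord p.1 p.2.
  move=> ij; have : T (chord i j) \in segments n.-1.
    by apply: Tseg; rewrite segmentsE; apply/imsetP; exists (i, j); rewrite ?inE.
  by rewrite segmentsE => /imsetP[p]; rewrite inE => pp ->; exists p.
have To a : T (chord o o) = chord a a by rewrite !chordxx linear0.
have adjT j k a b c d : j != k -> T (chord o j) = chord a b ->
    T (chord o k) = chord c d -> a != b -> c != d ->
    [|| a == c, a == d, b == c | b == d].
  move=> /seg[p [_ E]] Ej Ek; apply: chord_adj (p.1) (p.2) _.
  by rewrite -Ej -Ek -linearD chordD.
have [j1 j1o] : exists j1, j1 != o.
  apply/existsP; apply: contraT => /existsPn N.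
  by have := cardC1 o; rewrite card_ord eq_card0 => [|j]; [lia | apply/negbTE/N].
have [[a b1] /= [ab1 E1]] : exists p : 'I_n * 'I_n,
    p.1 != p.2 /\ T (chord o j1) = chord p.1 p.2 by apply: seg; rewrite eq_sym.
(* With only two vertices there is a single edge, and either end of its image serves as the
   centre. *)
have [/existsP[j2 /andP[j2o j21]]|/existsPn N] :=
  boolP [exists j, (j != o) && (j != j1)]; last first.
  exists a => j; have := N j; rewrite negb_and !negbK => /orP[]/eqP->.
    by exists a.
  by exists b1.
have [[c d] /= [cd E2]] : exists p : 'I_n * 'I_n,
    p.1 != p.2 /\ T (chord o j2) = chord p.1 p.2 by apply: seg; rewrite eq_sym.
(* The images of the first two edges meet; their ends are renamed so that the common one is a. *)
have {a b1 c d ab1 cd E1 E2} [a [b1 [b2 [ab1 ab2 E1 E2]]]] :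
    exists a b1 b2, [/\ a != b1, a != b2,
      T (chord o j1) = chord a b1 & T (chord o j2) = chord a b2].
  have := adjT j2 j1 c d a b1 j21 E2 E1 cd ab1.
  case/or4P => /eqP E; rewrite {}E in E2 cd.
  - by exists a, b1, d.
  - by exists b1, a, d; split; rewrite // 1?eq_sym // [RHS]chordC.
  - by exists a, b1, c; split; rewrite // 1?eq_sym // [RHS]chordC.
  - by exists b1, a, c; split; rewrite // 1?eq_sym // [RHS]chordC.
exists a => j.
have [->|jo] := eqVneq j o; first by exists a.
have [->|j_1] := eqVneq j j1; first by exists b1.
have [->|j_2] := eqVneq j j2; first by exists b2.
have [[c d] /= [cd E]] : exists p : 'I_n * 'I_n,
    p.1 != p.2 /\ T (chord o j) = chord p.1 p.2 by apply: seg; rewrite eq_sym.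
have [ca|ca] := eqVneq c a; first by exists d; rewrite -ca.
have [da|da] := eqVneq d a; first by exists c; rewrite -da E chordC.
(* An image avoiding a must meet both a b1 and a b2, so it is b1 b2, which closes the triangle. *)
have F1 := adjT j j1 c d a b1 j_1 E E1 cd ab1.
have F2 := adjT j j2 c d a b2 j_2 E E2 cd ab2.
have E12 : T (chord j1 j2) = chord b1 b2.
  by rewrite -(chordD o) linearD E1 E2 chordD.
have b12 : b1 != b2.
  apply: contra j21 => /eqP bE; rewrite eq_sym -chord_eq0.
  by apply/eqP/Tinj; rewrite E12 bE chordxx linear0.
(* Injectivity would then identify the edges o j and j1 j2, although o differs from j1 and j2. *)
suff /Tinj/chord_inj : T (chord o j) = T (chord j1 j2).
  rewrite eq_sym in j21; case/(_ j21) => -[EE]; subst; by rewrite eqxx in j1o j2o.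
rewrite E E12; move: F1 F2; rewrite (negPf ca) (negPf da) /=.
by case/orP => /eqP X /orP[] /eqP Y; subst; rewrite ?eqxx // in b12 *; rewrite chordC.
Qed.

(** Adding the images of o i and o j cancels the centre a. Injectivity of T makes b injective, hence
    a permutation of the finite vertex set. *)
Lemma segment_preserving_perm (hn : (2 <= n)%N)
    (T : {linear 'cV['F_2]_n.-1 -> 'cV['F_2]_n.-1}) : injective T ->
    (forall x, x \in segments n.-1 -> T x \in segments n.-1) ->
  exists s : 'S_n, forall i j, T (chord i j) = chord (s i) (s j).
Proof.
move=> Tinj Tseg.
have [a /fin_all_exists[b Eb]] := chord_star hn (Ordinal (ltnW hn)) Tinj Tseg.
have Tb i j : T (chord i j) = chord (b i) (b j).
  by rewrite -(chordD (Ordinal (ltnW hn))) linearD !Eb chordD.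
have binj : injective b.
  move=> i j bij; apply/eqP; rewrite -chord_eq0.
  by apply/eqP/Tinj; rewrite Tb bij chordxx linear0.
by exists (perm binj) => i j; rewrite Tb !permE.
Qed.

End Chords.

(** * Matrices with a prescribed column set, and the equivalence *)

Lemma columns_enum d (S : {set 'cV['F_2]_d}) :
  columns (\matrix_(i < d, j < #|S|) (enum_val j) i 0) = S.
Proof.
have colE j : col j (\matrix_(i < d, j < #|S|) (enum_val j) i 0) = enum_val j.
  by apply/matrixP => i o; rewrite !mxE ord1.
apply/setP => x; apply/imsetP/idP => [[j _ ->]|xS].
  by rewrite colE enum_valP.
by exists (enum_rank_in xS x); rewrite // colE enum_rankK_in.
Qed.

Lemma columns_mul d m (M : 'M['F_2]_d) (A : 'M['F_2]_(d, m)) :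
  columns (M *m A) = mulmx M @: columns A.
Proof.
by rewrite -imset_comp; apply: eq_imset => j /=; rewrite !colE mulmxA.
Qed.

Theorem theorem4 (n : nat) (hn : (2 <= n)%N) (G H : sgraph)
    (hG : #|vertex G| = n) (hH : #|vertex H| = n)
    (v : 'I_n -> vertex G) (hv : bijective v)
    (w : 'I_n -> vertex H) (hw : bijective w) :
  graph_iso G H <->
  strongly_iso (column_matroid (coding_seq v)) (column_matroid (coding_seq w)).
Proof.
rewrite !coding_seqE.
set rG := (fun i j => adj (v i) (v j)); set rH := (fun i j => adj (w i) (w j)).
have memG i j : (chord i j \in chords rG) = rG i j.
  by apply: mem_chords => [x y|x]; [apply: adj_sym | apply: adj_irr].
have memH i j : (chord i j \in chords rH) = rH i j.
  by apply: mem_chords => [x y|x]; [apply: adj_sym | apply: adj_irr].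
have subseg (K : sgraph) (u : 'I_n -> vertex K) :
    chords (fun i j => adj (u i) (u j)) \subset segments n.-1.
  rewrite segmentsE; apply/subsetP => x /imsetP[[i j]]; rewrite inE /= => uij ->.
  apply/imsetP; exists (i, j); rewrite ?inE //=.
  by apply: contraTneq uij => ->; rewrite adj_irr.
case: hv hw => v' vK v'K [w' wK w'K]; split.
- case=> f [f' fK f'K] fadj.
  (* The graph isomorphism read on labels, to be turned into a linear map. *)
  have sinj : injective (fun i => w' (f (v i))).
    by apply: inj_comp (can_inj w'K) _; apply: inj_comp (can_inj fK) (can_inj vK).
  pose s := perm sinj.
  have srel i j : rH (s i) (s j) = rG i j by rewrite /rH !permE !w'K fadj.
  pose M := vertex_perm_mx s.
  have MK p : cancel (@mulmx _ _ _ p M) (mulmx (vertex_perm_mx s^-1)).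
    by move=> x; rewrite mulmxA vertex_perm_mxK mul1mx.
  have MK' p : cancel (mulmx (vertex_perm_mx s^-1)) (@mulmx _ _ _ p M).
    move=> x; have := vertex_perm_mxK s^-1.
    by rewrite invgK mulmxA => ->; rewrite mul1mx.
  (* Enumerating the code of G gives distinct columns; [M *m A] then represents H with the same
     number of columns. *)
  pose A := \matrix_(i < n.-1, j < #|chords rG|) (enum_val j) i 0.
  have AE : columns A = chords rG by apply: columns_enum.
  have Acol j : col j A = enum_val j by apply/matrixP => i o; rewrite !mxE ord1.
  have MAE : columns (M *m A) = chords rH.
    by rewrite columns_mul AE; apply: vertex_perm_chords.
  split; first by lia.
  exists #|chords rG|, A, (M *m A); rewrite /simple_segment AE MAE; split.
  + split=> //; split; last exact: subseg.
    by move=> i j; rewrite !Acol => /enum_val_inj.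
  + split=> //; split; last exact: subseg.
    have MAcol j : col j (M *m A) = M *m enum_val j.
      by rewrite colE -mulmxA -colE Acol.
    by move=> i j; rewrite !MAcol => /(can_inj (MK _))/enum_val_inj.
  + exists (mulmx M : {linear _ -> _}).
    split; first by exists (mulmx (vertex_perm_mx s^-1)).
      split; first by move=> x y _ _ /=; apply: (can_inj (MK _)).
      rewrite segmentsE; apply: vertex_perm_chords => i j.
      by rewrite (inj_eq perm_inj).
    by split; [move=> x y _ _ /=; apply: (can_inj (MK _)) | exact: vertex_perm_chords].
- case=> _ [m [A1 [A2 [[_ E1] [_ E2] [T [Tbij [_ Tseg] [_ TA]]]]]]].
  have Tinj := bij_inj Tbij.
  (* The ground set of a column matroid is its column set, so equal matroids have equal column
     sets. *)
  have /= {E1} E1 := congr1 (@ground _) E1; have /= {E2} E2 := congr1 (@ground _) E2.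
  have Tin x : x \in segments n.-1 -> T x \in segments n.-1.
    by move=> xS; rewrite -Tseg; apply: imset_f.
  have [s sE] := segment_preserving_perm hn Tinj Tin.
  (* Adjacency is membership of a chord in the code, and the injective T carries one code onto the
     other. *)
  have srel i j : rH (s i) (s j) = rG i j.
    by rewrite -memH -memG -sE E1 E2 -TA (mem_imset _ _ Tinj).
  exists (fun x => w (s (v' x))).
    exists (fun y => v ((s^-1)%g (w' y))) => x; first by rewrite wK permK v'K.
    by rewrite vK permKV w'K.
  by move=> x y; have := srel (v' x) (v' y); rewrite /rH /rG !v'K.
Qed.
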